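(* Let $N_2\in\mathbb{R}^{m\times n}$ be an entrywise nonnegative matrix of rank $2$ with no zero row and no zero column, with scaled singular value decomposition $N_2=\begin{bmatrix}\hat{\mathbf u}_1&\hat{\mathbf u}_2\end{bmatrix}\begin{bmatrix}\hat{\mathbf v}_1&\hat{\mathbf v}_2\end{bmatrix}^\top$, and assume that $\hat{\mathbf u}_1$ and $\hat{\mathbf v}_1$ are both entrywise positive. Then the pairs $(L,R)$ with $L\in\mathbb{R}^{m\times 2}$, $R\in\mathbb{R}^{n\times 2}$, $L\ge 0$, $R\ge 0$ and $N_2=LR^\top$ are exactly the pairs of the form $$L=\begin{bmatrix}\hat{\mathbf u}_1&\hat{\mathbf u}_2\end{bmatrix}TDP,\qquad R^\top=(TDP)^{-1}\begin{bmatrix}\hat{\mathbf v}_1^\top\\ \hat{\mathbf v}_2^\top\end{bmatrix},$$ where $D=\begin{bmatrix}d_1&0\\0&d_2\end{bmatrix}$ with $d_1,d_2>0$, $P$ is a $2\times2$ permutation matrix, and $T=\begin{bmatrix}1&t_2\\t_1&-1\end{bmatrix}$ with $t_1,t_2>0$ satisfying $$\max\nolimits_{\hat v}\le t_1\le -1/\min\nolimits_{\hat u},\qquad \max\nolimits_{\hat u}\le t_2\le -1/\min\nolimits_{\hat v}.$$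
   Context: For matrices, $\ge 0$ means entrywise nonnegative. If $N_2=\sigma_1\mathbf u_1\mathbf v_1^\top+\sigma_2\mathbf u_2\mathbf v_2^\top$ is a singular value decomposition with $\sigma_1\ge\sigma_2>0$, the scaled singular value decomposition uses $\hat{\mathbf u}_k=\sigma_k^{1/2}\mathbf u_k$, $\hat{\mathbf v}_k=\sigma_k^{1/2}\mathbf v_k$ for $k=1,2$. Let $\hat u_{i,k}$ (resp. $\hat v_{j,k}$) denote the $i$-th (resp. $j$-th) entry of $\hat{\mathbf u}_k$ (resp. $\hat{\mathbf v}_k$), and define $$\min\nolimits_{\hat u}=\min_i\frac{\hat u_{i,2}}{\hat u_{i,1}},\quad \max\nolimits_{\hat u}=\max_i\frac{\hat u_{i,2}}{\hat u_{i,1}},\quad \min\nolimits_{\hat v}=\min_j\frac{\hat v_{j,2}}{\hat v_{j,1}},\quad \max\nolimits_{\hat v}=\max_j\frac{\hat v_{j,2}}{\hat v_{j,1}}.$$ (Since $\hat{\mathbf u}_1,\hat{\mathbf v}_1$ are positive and orthogonal to $\hat{\mathbf u}_2,\hat{\mathbf v}_2$ respectively, the two minima are negative and the two maxima are positive.) *)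

(* Defs.v *)
From mathcomp Require Import all_boot all_order all_algebra.
Set Implicit Arguments.
Unset Strict Implicit.
Unset Printing Implicit Defensive.
Import Order.TTheory GRing.Theory Num.Theory.
Local Open Scope ring_scope.

(* Extrema of a family indexed by 'I_m; the default value is the first member
   of the family, so these are honest extrema for m > 0 (and 0 for m = 0), as
   fmin_attained, fmin_le, fmax_attained, fmax_ge show. *)
Definition fmin (R : realDomainType) (m : nat) (f : 'I_m -> R) : R :=
  \big[Num.min/head 0 (codom f)]_(i < m) f i.

Definition fmax (R : realDomainType) (m : nat) (f : 'I_m -> R) : R :=
  \big[Num.max/head 0 (codom f)]_(i < m) f i.

Definition mx22 (R : pzRingType) (a b c d : R) : 'M[R]_2 :=
  block_mx (a%:M : 'M_1) (b%:M : 'M_1) (c%:M : 'M_1) (d%:M : 'M_1).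

Definition cols2 (R : Type) (m : nat) (x y : 'cV[R]_m) : 'M[R]_(m, 2) :=
  row_mx x y.

Definition is_svd2 (R : realDomainType) (m n : nat) (N : 'M[R]_(m, n))
    (s1 s2 : R) (u1 u2 : 'cV[R]_m) (v1 v2 : 'cV[R]_n) : Prop :=
  [/\ 0 < s2 <= s1,
      (cols2 u1 u2)^T *m cols2 u1 u2 = 1%:M,
      (cols2 v1 v2)^T *m cols2 v1 v2 = 1%:M
    & N = s1 *: (u1 *m v1^T) + s2 *: (u2 *m v2^T)].

(* (uh1, uh2, vh1, vh2) is the scaled form, with the factor sqrt(s_k) put on
   both sides, of some singular value decomposition of N. *)
Definition is_scaled_svd2 (R : rcfType) (m n : nat) (N : 'M[R]_(m, n))
    (uh1 uh2 : 'cV[R]_m) (vh1 vh2 : 'cV[R]_n) : Prop :=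
  exists s1 s2 : R, exists u1 u2 : 'cV[R]_m, exists v1 v2 : 'cV[R]_n,
    [/\ is_svd2 N s1 s2 u1 u2 v1 v2,
        uh1 = Num.sqrt s1 *: u1, uh2 = Num.sqrt s2 *: u2,
        vh1 = Num.sqrt s1 *: v1 & vh2 = Num.sqrt s2 *: v2].

Definition min_ratio (R : realFieldType) (m : nat) (x1 x2 : 'cV[R]_m) : R :=
  fmin (fun i => x2 i 0 / x1 i 0).

Definition max_ratio (R : realFieldType) (m : nat) (x1 x2 : 'cV[R]_m) : R :=
  fmax (fun i => x2 i 0 / x1 i 0).

Lemma head_codom (R : nmodType) (m : nat) (f : 'I_m.+1 -> R) :
  head 0 (codom f) = f ord0.
Proof. by rewrite codomE enum_ordSl. Qed.

Lemma fmin_attained (R : realDomainType) (m : nat) (f : 'I_m.+1 -> R) :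
  exists i, fmin f = f i.
Proof.
rewrite /fmin head_codom; elim/big_ind: _ => [|x y [i ->] [j ->]|i _].
- by exists ord0.
- by rewrite minEle; case: ifP => _; [exists i | exists j].
- by exists i.
Qed.

Lemma fmin_le (R : realDomainType) (m : nat) (f : 'I_m -> R) (i : 'I_m) :
  fmin f <= f i.
Proof. exact: bigmin_le_cond. Qed.

Lemma fmax_attained (R : realDomainType) (m : nat) (f : 'I_m.+1 -> R) :
  exists i, fmax f = f i.
Proof.
rewrite /fmax head_codom; elim/big_ind: _ => [|x y [i ->] [j ->]|i _].
- by exists ord0.
- by rewrite maxEle; case: ifP => _; [exists j | exists i].
- by exists i.
Qed.

Lemma fmax_ge (R : realDomainType) (m : nat) (f : 'I_m -> R) (i : 'I_m) :
  f i <= fmax f.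
Proof. exact: le_bigmax_cond. Qed.

(* Main.v *)
Require Import Defs.
From mathcomp Require Import all_boot all_order all_algebra.
From mathcomp Require Import fingroup perm ring lra.
Import Order.TTheory GRing.Theory Num.Theory.
Local Open Scope ring_scope.

(* Write U = [uh1 uh2] and V = [vh1 vh2]. Since U^T U = V^T V = diag(s1, s2) is
   invertible, every factorization N2 = L R^T comes from a unique invertible M
   with L = U M and R = V M^-T, and right multiplication by a permutation matrix
   makes det M negative. Nonnegativity of L and R then only depends on the
   extreme values of the ratios of the entries, and it turns into eight affine
   inequalities in the entries of M. As the minimal ratios are negative and the
   maximal ones positive (orthogonality to a positive vector), these
   inequalities force the sign pattern [+ +; + -] of T D on M, and scaling the
   columns gives the windows for t1 and t2. *)

(** * Calculus of two-by-two and two-column matrices *)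

Lemma mx22E (R : pzRingType) (a b c d : R) :
  (mx22 a b c d 0 0 = a) * (mx22 a b c d 0 1 = b) *
  (mx22 a b c d 1 0 = c) * (mx22 a b c d 1 1 = d).
Proof.
(* Block entries are reached through [lshift] and [rshift], so the indices 0 and 1 are first put in
   that form. *)
have i0 : 0 = lshift 1 0 :> 'I_(1 + 1) by exact: val_inj.
have i1 : 1 = rshift 1 0 :> 'I_(1 + 1) by exact: val_inj.
have E (i j i' j' : 'I_(1 + 1)) : i = i' -> j = j' ->
    mx22 a b c d i j = @fun_of_matrix _ (1 + 1) (1 + 1) (mx22 a b c d) i' j'.
  by move=> -> ->.
rewrite (E _ _ _ _ i0 i0) (E _ _ _ _ i0 i1) (E _ _ _ _ i1 i0)
  (E _ _ _ _ i1 i1) /mx22.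
by rewrite block_mxEul block_mxEur block_mxEdl block_mxEdr !mxE.
Qed.

Lemma ord2P (i : 'I_2) : i = 0 \/ i = 1.
Proof. by case: i => [[|[|//]] ?]; [left | right]; exact: val_inj. Qed.

Lemma mx22_eta (R : pzRingType) (A : 'M[R]_2) :
  A = mx22 (A 0 0) (A 0 1) (A 1 0) (A 1 1).
Proof.
by apply/matrixP=> i j; case: (ord2P i) => ->; case: (ord2P j) => ->;
  rewrite mx22E.
Qed.

Lemma mx22_mul (R : pzRingType) (a b c d a' b' c' d' : R) :
  mx22 a b c d *m mx22 a' b' c' d' =
  mx22 (a * a' + b * c') (a * b' + b * d') (c * a' + d * c') (c * b' + d * d').
Proof.
by rewrite /mx22 (@mulmx_block R 1 1 1 1 1 1) -!scalar_mxM -!raddfD.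
Qed.

Lemma tr_mx22 (R : pzRingType) (a b c d : R) : (mx22 a b c d)^T = mx22 a c b d.
Proof. by rewrite [LHS]mx22_eta !(mxE trmx_key) !mx22E. Qed.

Lemma oppr_mx22 (R : pzRingType) (a b c d : R) :
  - mx22 a b c d = mx22 (- a) (- b) (- c) (- d).
Proof.
have oppE (A : 'M[R]_2) i j : (- A) i j = - A i j by rewrite mxE.
by rewrite [LHS]mx22_eta !oppE !mx22E.
Qed.

Lemma mx22_scalar (R : pzRingType) (a : R) : mx22 a 0 0 a = a%:M.
Proof. by rewrite /mx22 raddf0 -scalar_mx_block. Qed.

Lemma det_mx22 (R : comPzRingType) (a b c d : R) :
  \det (mx22 a b c d) = a * d - b * c.
Proof.
have det2 (A : 'M[R]_2) : \det A = A 0 0 * A 1 1 - A 0 1 * A 1 0.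
  rewrite (expand_det_row _ 0) !big_ord_recl big_ord0 /cofactor !det_mx11 !mxE.
  rewrite addr0 expr0 mul1r expr1 mulN1r mulrN.
  by congr (_ * A _ _ - A _ _ * A _ _); exact: val_inj.
by rewrite det2 !mx22E.
Qed.

Lemma invmx_mx22 (R : fieldType) (a b c d : R) : a * d - b * c != 0 ->
  invmx (mx22 a b c d) = (a * d - b * c)^-1 *: mx22 d (- b) (- c) a.
Proof.
set e := a * d - b * c => e_neq0.
have eM : mx22 a b c d *m (e^-1 *: mx22 d (- b) (- c) a) = 1%:M.
  rewrite -scalemxAr mx22_mul.
  rewrite (_ : mx22 _ _ _ _ = e%:M); last first.
    by rewrite -mx22_scalar /e; f_equal; ring.
  by rewrite scale_scalar_mx mulVf.
have uM : mx22 a b c d \in unitmx by case: (mulmx1_unit eM).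
by rewrite -[RHS]mul1mx -(mulVmx uM) -mulmxA eM mulmx1.
Qed.

Lemma cols2E (R : Type) (m : nat) (x y : 'cV[R]_m) (i : 'I_m) :
  (cols2 x y i 0 = x i 0) * (cols2 x y i 1 = y i 0).
Proof.
split; first by rewrite -(row_mxEl x y); congr (_ i _); exact: val_inj.
by rewrite -(row_mxEr x y); congr (_ i _); exact: val_inj.
Qed.

Lemma cols2_mul_mx22 (R : pzRingType) (m : nat) (x y : 'cV[R]_m) (a b c d : R) :
  cols2 x y *m mx22 a b c d =
  cols2 (x *m a%:M + y *m c%:M) (x *m b%:M + y *m d%:M).
Proof. exact: (@mul_row_block R m 1 1 1 1). Qed.

Lemma cols2_mul_mx22E (R : pzRingType) (m : nat) (x y : 'cV[R]_m)
    (a b c d : R) (i : 'I_m) :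
  ((cols2 x y *m mx22 a b c d) i 0 = x i 0 * a + y i 0 * c) *
  ((cols2 x y *m mx22 a b c d) i 1 = x i 0 * b + y i 0 * d).
Proof.
by rewrite cols2_mul_mx22 !cols2E !mxE !big_ord1 !mxE !eqxx !mulr1n.
Qed.

Lemma cols2_gram (R : pzRingType) (m : nat) (x y : 'cV[R]_m) (a b : R) :
  (cols2 x y)^T *m cols2 x y = mx22 a 0 0 b ->
  x^T *m y = 0 /\ y^T *m y = b%:M.
Proof.
rewrite /cols2 /mx22 (@tr_row_mx R m 1 1) (@mul_col_row R 1 1 m 1 1).
by case/(@eq_block_mx R 1 1 1 1)=> _ -> _ ->; rewrite raddf0.
Qed.

(** * Gram matrices and signs of the ratios *)

(** Scaling multiplies orthonormal columns by [diag(sqrt s1, sqrt s2)] on both sides, whence a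
    common diagonal Gram matrix. *)
Lemma scaled_svd2_gram (R : rcfType) (m n : nat) (N : 'M[R]_(m, n))
    (x1 x2 : 'cV[R]_m) (y1 y2 : 'cV[R]_n) : is_scaled_svd2 N x1 x2 y1 y2 ->
  N = cols2 x1 x2 *m (cols2 y1 y2)^T /\
  exists s1 s2 : R, [/\ 0 < s1, 0 < s2,
    (cols2 x1 x2)^T *m cols2 x1 x2 = mx22 s1 0 0 s2
  & (cols2 y1 y2)^T *m cols2 y1 y2 = mx22 s1 0 0 s2].
Proof.
case=> s1 [s2 [u1 [u2 [v1 [v2]]]]].
case=> -[/andP[s2_gt0 les] uK vK ->] -> -> -> ->.
have s1_gt0 := lt_le_trans s2_gt0 les.
have gram p (w1 w2 : 'cV[R]_p) : (cols2 w1 w2)^T *m cols2 w1 w2 = 1%:M ->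
    (cols2 (Num.sqrt s1 *: w1) (Num.sqrt s2 *: w2))^T
      *m cols2 (Num.sqrt s1 *: w1) (Num.sqrt s2 *: w2) = mx22 s1 0 0 s2.
  move=> wK.
  have -> : cols2 (Num.sqrt s1 *: w1) (Num.sqrt s2 *: w2) =
      cols2 w1 w2 *m mx22 (Num.sqrt s1) 0 0 (Num.sqrt s2).
    by rewrite cols2_mul_mx22 !mul_mx_scalar !scale0r addr0 add0r.
  rewrite trmx_mul mulmxA -(mulmxA _^T _^T) wK mulmx1 tr_mx22 mx22_mul.
  by rewrite !mul0r !mulr0 !addr0 add0r -!expr2 !sqr_sqrtr ?ltW.
split.
  rewrite /cols2 (@tr_row_mx R n 1 1) (@mul_row_col R m 1 1) !linearZ /=.
  rewrite -!scalemxAl !scalerA.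
  by rewrite -!expr2 !sqr_sqrtr ?ltW.
by exists s1, s2; split=> //; exact: gram.
Qed.

(** If [x2] had no negative entry, the zero sum [x1^T x2] would have nonnegative terms, so each
    would vanish and [x2] would be zero. *)
Lemma pos_orthogonal_lt0 (R : realDomainType) (m : nat) (x1 x2 : 'cV[R]_m) :
  x1 \is a mxOver Num.pos -> x1^T *m x2 = 0 -> x2 != 0 ->
  exists i, x2 i 0 < 0.
Proof.
move=> /mxOverP x1_gt0 x12 x2_neq0.
have [/existsP//|/existsPn x2_ge0] := boolP [exists i, x2 i 0 < 0].
case/eqP: x2_neq0; apply/colP=> i; rewrite mxE.
have /matrixP/(_ 0 0) := x12; rewrite !mxE => sum0.
have term_ge0 j : true -> 0 <= x1^T 0 j * x2 j 0.
  by rewrite mxE mulr_ge0 ?(ltW (x1_gt0 j 0)) // leNgt x2_ge0.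
have /eqP : x1^T 0 i * x2 i 0 = 0 := psumr_eq0P term_ge0 sum0 isT.
by rewrite mxE mulf_eq0 (gt_eqF (x1_gt0 i 0)) => /eqP.
Qed.

Lemma pos_orthogonal_ratio (R : realFieldType) (m : nat) (x1 x2 : 'cV[R]_m) :
  x1 \is a mxOver Num.pos -> x1^T *m x2 = 0 -> x2 != 0 ->
  min_ratio x1 x2 < 0 < max_ratio x1 x2.
Proof.
move=> x1_gt0 x12 x2_neq0.
have x1i i : 0 < x1 i 0 by rewrite -posrE (mxOverP x1_gt0).
have [i xi_lt0] := pos_orthogonal_lt0 _ _ _ _ x1_gt0 x12 x2_neq0.
(* A negative entry of [- x2] is a positive entry of [x2]. *)
have [||j] := pos_orthogonal_lt0 _ _ x1 (- x2) x1_gt0.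
- by rewrite mulmxN x12 oppr0.
- by rewrite oppr_eq0.
rewrite mxE oppr_lt0 => xj_gt0; apply/andP; split.
- by apply: le_lt_trans (fmin_le _ i) _; rewrite pmulr_llt0 ?invr_gt0.
- by apply: lt_le_trans (fmax_ge _ j); rewrite divr_gt0.
Qed.

(** * Nonnegativity through extreme ratios *)

(** An affine function is nonnegative on an interval as soon as it is so at both ends, and here the
    ends are attained values of [f]. *)
Lemma affine_ge0_extrema (R : realDomainType) (m : nat)
    (f : 'I_m -> R) (p q : R) :
  fmin f < 0 ->
  (forall i, 0 <= p + q * f i) <-> 0 <= p + q * fmin f /\ 0 <= p + q * fmax f.
Proof.
(* For an empty family [fmin f] is the default 0, which [fmin f < 0] excludes. *)
case: m f => [|m] f; first by rewrite /fmin big_ord0 codomE enum_ord0 ltxx.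
move=> _; split=> [f_ge0 | [min_ge0 max_ge0] i].
  by have [[i ->] [j ->]] := (fmin_attained f, fmax_attained f).
have := (fmin_le f i, fmax_ge f i) => -[lei gei].
by have [q_ge0 | /ltW q_le0] := leP 0 q; nra.
Qed.

(** Dividing by the positive [x1 i 0] leaves an affine function of the ratio. *)
Lemma comb_ge0_ratio (R : realFieldType) (m : nat) (x1 x2 : 'cV[R]_m) (p q : R) :
  x1 \is a mxOver Num.pos -> min_ratio x1 x2 < 0 ->
  (forall i, 0 <= x1 i 0 * p + x2 i 0 * q) <->
  0 <= p + q * min_ratio x1 x2 /\ 0 <= p + q * max_ratio x1 x2.
Proof.
move=> x1_gt0 min_lt0.
have x1i i : 0 < x1 i 0 by rewrite -posrE (mxOverP x1_gt0).
have combE i : x1 i 0 * p + x2 i 0 * q = x1 i 0 * (p + q * (x2 i 0 / x1 i 0)).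
  by field; rewrite gt_eqF.
apply: iff_trans (affine_ge0_extrema _ _ _ p q min_lt0).
by split=> comb_ge0 i; have := comb_ge0 i; rewrite combE pmulr_rge0.
Qed.

Lemma cols2_mx22_ge0 (R : realFieldType) (m : nat) (x1 x2 : 'cV[R]_m)
    (a b c d : R) :
  x1 \is a mxOver Num.pos -> min_ratio x1 x2 < 0 ->
  cols2 x1 x2 *m mx22 a b c d \is a mxOver Num.nneg <->
  [/\ 0 <= a + c * min_ratio x1 x2, 0 <= a + c * max_ratio x1 x2,
      0 <= b + d * min_ratio x1 x2 & 0 <= b + d * max_ratio x1 x2].
Proof.
move=> x1_gt0 min_lt0.
have E := comb_ge0_ratio _ _ _ _ _ _ x1_gt0 min_lt0.
split=> [/mxOverP H | [Ha1 Ha2 Hb1 Hb2]].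
- have [|? ?] := (E a c).1.
    by move=> i; have := H i 0; rewrite cols2_mul_mx22E nnegrE.
  have [|? ?] := (E b d).1.
    by move=> i; have := H i 1; rewrite cols2_mul_mx22E nnegrE.
  by split.
- apply/mxOverP=> i j; rewrite nnegrE.
  have [->|->] := ord2P j.
  + by rewrite cols2_mul_mx22E; apply: (E a c).2.
  + by rewrite cols2_mul_mx22E; apply: (E b d).2.
Qed.

(** The value [p] at 0 lies between the values at [y] and [z], so it is nonnegative; if it were 0,
    the opposite signs of [y] and [z] would force [q = 0]. *)
Lemma affine_ge0_gt0 (R : realDomainType) (y z p q : R) :
  y < 0 -> 0 < z -> 0 <= p + q * y -> 0 <= p + q * z -> (p, q) != (0, 0) ->
  0 < p.
Proof.
move=> y_lt0 z_gt0 py pz; rewrite xpair_eqE lt0r.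
have p_ge0 : 0 <= p by have [q_ge0 | /ltW q_le0] := leP 0 q; nra.
have [p0 /=|] := eqVneq p 0; last by rewrite p_ge0.
move: py pz; rewrite p0 !add0r nmulr_lge0 // pmulr_lge0 // => q_le0 q_ge0.
by rewrite eq_le q_le0 q_ge0.
Qed.

(* The first four inequalities say [U M >= 0], the last four [V M^-T >= 0], for
   [M = mx22 a b c d]; the positive factor [- 1 / \det M] of [M^-1] is dropped. *)
Lemma ratio_window (R : realFieldType) (a b c d mu xu mv xv : R) :
  a * d - b * c < 0 -> mu < 0 < xu -> mv < 0 < xv ->
  [/\ 0 <= a + c * mu, 0 <= a + c * xu, 0 <= b + d * mu & 0 <= b + d * xu] /\
  [/\ 0 <= - d + b * mv, 0 <= - d + b * xv,
      0 <= c + - a * mv & 0 <= c + - a * xv]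
  <->
  exists t1 t2 d1 d2 : R,
    [/\ [/\ 0 < t1, 0 < t2, 0 < d1 & 0 < d2],
        xv <= t1 <= - 1 / mu, xu <= t2 <= - 1 / mv
      & [/\ a = d1, b = t2 * d2, c = t1 * d1 & d = - d2]].
Proof.
move=> det_lt0 /andP[mu_lt0 xu_gt0] /andP[mv_lt0 xv_gt0].
have le_m1 (t z : R) : z < 0 -> (t <= - 1 / z) = (0 <= 1 + t * z).
  by move=> z_lt0; rewrite ler_ndivlMr //; apply/idP/idP=> ?; lra.
split=> [[[ac_mu ac_xu bd_mu bd_xu] [db_mv db_xv ca_mv ca_xv]] | ].
- have a_gt0 : 0 < a.
    apply: (affine_ge0_gt0 _ mu xu _ c) => //.
    (* A zero column would make the determinant vanish. *)
    by apply: contraTneq det_lt0 => -[-> ->]; rewrite mul0r mulr0 subrr ltxx.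
  have b_gt0 : 0 < b.
    apply: (affine_ge0_gt0 _ mu xu _ d) => //.
    by apply: contraTneq det_lt0 => -[-> ->]; rewrite mul0r mulr0 subrr ltxx.
  (* [db_mv] gives [d <= b * mv < 0], and [ca_xv] gives [c >= a * xv > 0]. *)
  have d_lt0 : d < 0 by nra.
  have c_gt0 : 0 < c by nra.
  (* The columns of [T D] are [(d1, t1 * d1)] and [(t2 * d2, - d2)], so these values are forced. *)
  exists (c / a), (b / - d), a, (- d).
  have nd_gt0 : 0 < - d by rewrite oppr_gt0.
  split; first by rewrite !divr_gt0.
  + rewrite le_m1 // ler_pdivlMr //; apply/andP; split; first lra.
    have -> : 1 + c / a * mu = (a + c * mu) / a by field; rewrite gt_eqF.
    by rewrite divr_ge0 // ltW.
  + rewrite le_m1 // ler_pdivlMr //; apply/andP; split; first lra.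
    have -> : 1 + b / - d * mv = (- d + b * mv) / - d.
      by field; rewrite lt_eqF.
    by rewrite divr_ge0 // ltW.
  + by split=> //; rewrite ?opprK // divfK ?gt_eqF.
- move=> [t1 [t2 [d1 [d2 [[t1_gt0 t2_gt0 d1_gt0 d2_gt0]]]]]].
  rewrite !le_m1 // => /andP[t1_ge t1_le] /andP[t2_ge t2_le] [-> -> -> ->].
  have ? : 0 < t1 * d1 by rewrite mulr_gt0.
  have ? : 0 < t2 * d2 by rewrite mulr_gt0.
  by split; split; rewrite ?opprK; nra.
Qed.

(** * Permutation matrices *)

Lemma perm_mx_inv (R : comUnitRingType) (n : nat) (P : 'M[R]_n) :
  is_perm_mx P -> P^T *m P = 1%:M.
Proof.
by case/is_perm_mxP=> s ->; rewrite tr_perm_mx -perm_mxM mulVg perm_mx1.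
Qed.

Lemma perm_mx_ge0 (R : numDomainType) (n : nat) (P : 'M[R]_n) :
  is_perm_mx P -> P \is a mxOver Num.nneg.
Proof.
case/is_perm_mxP=> s ->; apply/mxOverP=> i j.
by rewrite !mxE; case: eqP => _; rewrite ?rpred0 ?rpred1.
Qed.

(** Since [P] is orthogonal, [P^-T = P]: replacing [M] by [M P] permutes the columns of [U M] and of
    [V M^-T] in the same way. *)
Lemma trinv_mul_perm (R : comUnitRingType) (n : nat) (A P : 'M[R]_n) :
  A \in unitmx -> is_perm_mx P -> (invmx (A *m P))^T = (invmx A)^T *m P.
Proof.
move=> uA /perm_mx_inv PK; have [_ uP] := mulmx1_unit PK.
have PKr := mulmx1C PK.
have APK : A *m P *m (P^T *m invmx A) = 1%:M.
  by rewrite mulmxA -(mulmxA A) PKr mulmx1 mulmxV.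
rewrite -[P in RHS]trmxK -trmx_mul; congr trmx.
by rewrite -[LHS]mulmx1 -APK mulKmx // unitmx_mul uA.
Qed.

(** * The factorizations *)

(** This is the characterization once the permutation is normalized away by the sign of the
    determinant. *)
Lemma nneg_pair_neg_det (R : realFieldType) (m n : nat)
    (x1 x2 : 'cV[R]_m) (y1 y2 : 'cV[R]_n) (M : 'M[R]_2) :
  x1 \is a mxOver Num.pos -> y1 \is a mxOver Num.pos ->
  min_ratio x1 x2 < 0 < max_ratio x1 x2 ->
  min_ratio y1 y2 < 0 < max_ratio y1 y2 -> \det M < 0 ->
  (cols2 x1 x2 *m M \is a mxOver Num.nneg /\
   cols2 y1 y2 *m (invmx M)^T \is a mxOver Num.nneg) <->
  exists t1 t2 d1 d2 : R,
    [/\ [/\ 0 < t1, 0 < t2, 0 < d1 & 0 < d2],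
        max_ratio y1 y2 <= t1 <= - 1 / min_ratio x1 x2,
        max_ratio x1 x2 <= t2 <= - 1 / min_ratio y1 y2
      & M = mx22 1 t2 t1 (-1) *m mx22 d1 0 0 d2].
Proof.
move=> x1_gt0 y1_gt0 xr yr.
have [xmin_lt0 ymin_lt0] : min_ratio x1 x2 < 0 /\ min_ratio y1 y2 < 0.
  by case/andP: xr; case/andP: yr.
rewrite [M]mx22_eta; move: (M 0 0) (M 0 1) (M 1 0) (M 1 1) => a b c d {M}.
rewrite det_mx22 => det_lt0.
have nnegV : cols2 y1 y2 *m (invmx (mx22 a b c d))^T \is a mxOver Num.nneg <->
    cols2 y1 y2 *m mx22 (- d) c b (- a) \is a mxOver Num.nneg.
  have -> : (invmx (mx22 a b c d))^T =
      (- (a * d - b * c))^-1 *: mx22 (- d) c b (- a).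
    rewrite invmx_mx22 ?lt_eqF // linearZ /= tr_mx22 invrN scaleNr -scalerN.
    by congr (_ *: _); rewrite oppr_mx22 !opprK.
  have scaleE (A : 'M[R]_(n, 2)) k i j : (k *: A) i j = k * A i j.
    by rewrite mxE.
  rewrite -scalemxAr; split=> /mxOverP nn; apply/mxOverP=> i j; move: (nn i j);
    by rewrite scaleE !nnegrE pmulr_rge0 // invr_gt0 oppr_gt0.
rewrite nnegV (cols2_mx22_ge0 _ _ _ _ _ _ _ _ x1_gt0 xmin_lt0).
rewrite (cols2_mx22_ge0 _ _ _ _ _ _ _ _ y1_gt0 ymin_lt0).
rewrite (ratio_window _ _ _ _ _ _ _ _ _ det_lt0 xr yr).
split=> -[t1 [t2 [d1 [d2 [pos t1P t2P eM]]]]]; exists t1, t2, d1, d2; split=> //.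
  by case: eM => -> -> -> ->; rewrite mx22_mul; f_equal; ring.
have entry i j := congr1 (fun A : 'M[R]_2 => A i j) eM.
have := (entry 0 0, entry 0 1, entry 1 0, entry 1 1).
by rewrite mx22_mul /= !mx22E => -[[[-> ->] ->] ->]; split; ring.
Qed.

Theorem theorem2p8 (R : rcfType) (m n : nat) (N2 : 'M[R]_(m, n))
    (uh1 uh2 : 'cV[R]_m) (vh1 vh2 : 'cV[R]_n)
    (N2_ge0 : N2 \is a mxOver Num.nneg)
    (rank_N2 : \rank N2 = 2%N)
    (row_neq0 : forall i : 'I_m, row i N2 != 0)
    (col_neq0 : forall j : 'I_n, col j N2 != 0)
    (svd_N2 : is_scaled_svd2 N2 uh1 uh2 vh1 vh2)
    (uh1_gt0 : uh1 \is a mxOver Num.pos)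
    (vh1_gt0 : vh1 \is a mxOver Num.pos)
    (LL : 'M[R]_(m, 2)) (RR : 'M[R]_(n, 2)) :
  [/\ LL \is a mxOver Num.nneg, RR \is a mxOver Num.nneg & N2 = LL *m RR^T]
  <->
  exists t1 t2 d1 d2 : R, exists P : 'M[R]_2,
    let T := mx22 1 t2 t1 (-1) in
    let D := mx22 d1 0 0 d2 in
    [/\ [/\ 0 < t1, 0 < t2, 0 < d1, 0 < d2 & is_perm_mx P],
        max_ratio vh1 vh2 <= t1 <= - 1 / min_ratio uh1 uh2,
        max_ratio uh1 uh2 <= t2 <= - 1 / min_ratio vh1 vh2,
        LL = cols2 uh1 uh2 *m (T *m D *m P)
      & RR^T = invmx (T *m D *m P) *m (cols2 vh1 vh2)^T].
Proof.
have [N2E [s1 [s2 [s1_gt0 s2_gt0 Ugram Vgram]]]] :=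
  scaled_svd2_gram _ _ _ _ _ _ _ _ svd_N2.
have ratioP p (x1 x2 : 'cV[R]_p) : x1 \is a mxOver Num.pos ->
    (cols2 x1 x2)^T *m cols2 x1 x2 = mx22 s1 0 0 s2 ->
    min_ratio x1 x2 < 0 < max_ratio x1 x2.
  move=> x1_gt0 /cols2_gram[x12 x22]; apply: pos_orthogonal_ratio => //.
  (* [x2 = 0] would contradict [x2^T x2 = s2 > 0]. *)
  apply/eqP=> x20; move: x22; rewrite x20 mulmx0 => /matrixP/(_ 0 0)/eqP.
  by rewrite !mxE eqxx mulr1n lt_eqF.
have ur := ratioP _ _ _ uh1_gt0 Ugram; have vr := ratioP _ _ _ vh1_gt0 Vgram.
have uG : mx22 s1 0 0 s2 \in unitmx.
  by rewrite unitmxE det_mx22 mulr0 subr0 unitfE mulf_neq0 ?gt_eqF.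
set U := cols2 uh1 uh2; set V := cols2 vh1 vh2.
set G := mx22 s1 0 0 s2 in uG Ugram Vgram.
split=> [[L_ge0 R_ge0 N2L] | [t1 [t2 [d1 [d2 [P]]]]] /=].
(* Multiplying [U V^T = L R^T] on the right by [V G^-1] gives [U = L A]; then
   [M A = G^-1 U^T U = 1]. *)
- pose A := RR^T *m V *m invmx G; pose M := invmx G *m U^T *m LL.
  have UA : U = LL *m A.
    by rewrite /A !mulmxA -N2L N2E -(mulmxA U) Vgram mulmxK.
  have MA : M *m A = 1%:M.
    by rewrite /M -(mulmxA _ LL) -UA -mulmxA Ugram mulVmx.
  have [uM uA] := mulmx1_unit MA.
  have AE : invmx M = A by rewrite -[LHS]mulmx1 -MA mulKmx.
  have LM : LL = U *m M by rewrite UA -mulmxA (mulmx1C MA) mulmx1.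
  (* Insert [A M = 1] before [R^T] and use [M R^T = G^-1 U^T N2 = V^T]. *)
  have RA : RR^T = A *m V^T.
    rewrite -[LHS]mul1mx -(mulmx1C MA) -mulmxA; congr (_ *m _).
    rewrite /M -(mulmxA _ LL) -N2L N2E mulmxA -(mulmxA _ U^T) Ugram mulVmx //.
    by rewrite mul1mx.
  have RM : RR = V *m (invmx M)^T by rewrite -[LHS]trmxK RA trmx_mul trmxK AE.
  (* Swap the columns if the determinant is positive and keep them if it is negative; zero is
     excluded by invertibility. *)
  have [P [permP det_lt0]] :
      exists P : 'M[R]_2, is_perm_mx P /\ \det (M *m P) < 0.
    case: (ltrgt0P (\det M)) => detM.
    + exists (perm_mx (tperm 0 1)); split; first exact: perm_mx_is_perm.
      by rewrite det_mulmx det_perm odd_tperm expr1 mulrN1 oppr_lt0.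
    + by exists 1%:M; rewrite is_perm_mx1 mulmx1.
    + by move: uM; rewrite unitmxE detM unitr0.
  have [|t1 [t2 [d1 [d2 [[t1_gt0 t2_gt0 d1_gt0 d2_gt0] t1P t2P eM]]]]] :=
    (nneg_pair_neg_det _ _ _ _ _ _ _ _ uh1_gt0 vh1_gt0 ur vr det_lt0).1.
    rewrite trinv_mul_perm // -/U -/V (mulmxA U) (mulmxA V) -LM -RM.
    by split; apply: mxOverM => //; exact: perm_mx_ge0.
  (* From [M P = T D] follows [M = T D P^T]. *)
  exists t1, t2, d1, d2, P^T => /=.
  rewrite -eM -mulmxA (mulmx1C (perm_mx_inv _ _ _ permP)) mulmx1 is_perm_mx_tr.
  by rewrite AE.
- case=> [[t1_gt0 t2_gt0 d1_gt0 d2_gt0 permP] t1P t2P LE RE].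
  set M := mx22 1 t2 t1 (-1) *m mx22 d1 0 0 d2 in LE RE.
  (* The determinant is [(- 1 - t2 * t1) * (d1 * d2)]. *)
  have det_lt0 : \det M < 0.
    rewrite det_mulmx !det_mx22 mulr0 subr0 pmulr_llt0 ?mulr_gt0 //.
    by have := mulr_gt0 t2_gt0 t1_gt0; lra.
  have uM : M \in unitmx by rewrite unitmxE unitfE lt_eqF.
  have [_ uP] := mulmx1_unit (perm_mx_inv _ _ _ permP).
  have uMP : M *m P \in unitmx by rewrite unitmx_mul uM.
  have [|UM VM] :=
    (nneg_pair_neg_det _ _ _ _ _ _ _ _ uh1_gt0 vh1_gt0 ur vr det_lt0).2.
    by exists t1, t2, d1, d2.
  (* Thus [R] is the nonnegative matrix [V M^-T] with its columns permuted. *)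
  have RV : RR = V *m (invmx M)^T *m P.
    by rewrite -[LHS]trmxK RE trmx_mul trmxK trinv_mul_perm // mulmxA.
  split.
  + by rewrite LE mulmxA; apply: mxOverM => //; exact: perm_mx_ge0.
  + by rewrite RV; apply: mxOverM => //; exact: perm_mx_ge0.
  + by rewrite RE LE N2E -(mulmxA U) mulKVmx.
Qed.
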